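(* Let $\kappa$ be an infinite cardinal and $\ell\in\omega$. Assume $2^\lambda=\lambda^+$ for every cardinal $\lambda<\kappa^{+\omega}$. Let $n=R(\ell)$ and $m=n-1$. Then for every $n$-partite graph $G$ with parts $U_0,\dots,U_{n-1}$, each of cardinality $\kappa^{+m}$, there exist a set $y\subseteq\{0,\dots,n-1\}$ with $|y|=\ell$ and sets $A_i\subseteq U_i$ ($i\in y$) with $|A_i|=\kappa$, such that either for all distinct $i,j\in y$ every $a\in A_i$, $b\in A_j$ are joined by an edge (a clique), or for all distinct $i,j\in y$ no $a\in A_i$, $b\in A_j$ are joined by an edge (an independent set).
   Context: An $n$-partite graph is a graph whose vertex set is partitioned into $n$ pairwise disjoint sets $U_0,\dots,U_{n-1}$ such that no edge has both endpoints in the same $U_i$. $R(\ell)$ denotes the Ramsey number: the least $n$ such that every 2-coloring of the 2-element subsets of an $n$-element set has a monochromatic subset of size $\ell$. *)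

(* Defs.v *)
From mathcomp Require Import all_boot.
From mathcomp Require Import boolp classical_sets functions cardinality.

Set Implicit Arguments.
Unset Strict Implicit.
Unset Printing Implicit Defensive.

Local Open Scope classical_set_scope.
Local Open Scope card_scope.

(* Cardinals are represented by types, and compared through #<= and #= between  *)
(* full sets, so a cardinal is only determined up to equinumerosity.            *)

Definition card_lt (X Y : Type) : Prop :=
  ([set: X] #<= [set: Y]) /\ ~ ([set: Y] #<= [set: X]).

Definition least_card (P : Type -> Prop) (X : Type) : Prop :=
  P X /\ forall Y : Type, P Y -> [set: X] #<= [set: Y].

Lemma card_le_least_subset (X : Type) (Q : set (set X)) :
  Q !=set0 -> exists2 A, Q A & forall B, Q B -> A #<= B.
Proof.
move=> [A1 QA1].
pose P (R : set (set X -> X)) := forall A, Q A ->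
  (forall f, R f -> A (f A)) /\ (forall f g, R f -> R g -> f A = g A -> f = g).
have [F FP Ftot|R [PR maxR]] := @Zorn_bigcup _ P.
  move=> A QA; split=> [f [S FS Sf]|f g [S FS Sf] [S' FS' Sg]].
    exact: (FP _ FS A QA).1.
  have [SS'|S'S] := Ftot _ _ FS FS'.
    exact: (FP _ FS' A QA).2 (SS' _ Sf) Sg.
  exact: (FP _ FS A QA).2 Sf (S'S _ Sg).
have [[A0 QA0 A0R]|noA] := pselect (exists2 A, Q A &
    forall a, A a -> exists2 f, R f & f A = a).
  exists A0 => // B QB; apply: (@card_le_trans _ _ _ R).
    apply: card_le_trans (card_image_le (fun f : set X -> X => f A0) R).
    by apply: subset_card_le => a /A0R[f Rf <-]; exists f.
  have Rinj : {in R &, injective (fun f : set X -> X => f B)}.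
    by move=> f g; rewrite !inE => Rf Rg; exact: (PR B QB).2.
  have : R #= (fun f : set X -> X => f B) @` R by exact/card_esym/inj_card_eq.
  rewrite card_eq_le => /andP[/card_le_trans + _]; apply.
  by apply: subset_card_le => _ [f Rf <-]; exact: (PR B QB).1.
have fresh A : exists a, Q A -> A a /\ forall f, R f -> f A <> a.
  have [QA|NQA] := pselect (Q A); last first.
    have [[a _]|N] := pselect (exists a : X, True); first by exists a.
    exfalso; apply: noA; exists A1 => // a; by exfalso; apply: N; exists a.
  apply: contrapT => Na; apply: noA; exists A => // a Aa.
  apply: contrapT => Nf; apply: Na; exists a => _; split=> // f Rf fAa.
  by apply: Nf; exists f.
have [h hP] := choice fresh.
exfalso; apply: (maxR (R `|` [set h])).
  split; first by left.
  move=> /(_ h (or_intror erefl)) Rh.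
  exact: (hP A1 QA1).2 Rh erefl.
move=> A QA; split=> [f [Rf| ->]|f g [Rf|->] [Rg|->]] //.
- exact: (PR A QA).1.
- exact: (hP A QA).1.
- exact: (PR A QA).2.
- by move=> E; have := (hP A QA).2 f Rf E.
- by move=> /esym E; have := (hP A QA).2 g Rg E.
Qed.

Lemma card_leT_inj (X Y : Type) :
  [set: X] #<= [set: Y] -> exists f : X -> Y, injective f.
Proof.
move=> /card_leP[f]; exists (fun x => val (f (SigSub (in_setT x)))) => x y.
by move=> /val_inj/(@inj _ _ _ f)-/(_ (in_setT _) (in_setT _)) [].
Qed.

Lemma card_le_total (X Y : Type) :
  ([set: X] #<= [set: Y]) \/ ([set: Y] #<= [set: X]).
Proof.
pose A : set (X + Y) := range inl; pose B : set (X + Y) := range inr.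
have AX : A #= [set: X] by apply: inj_card_eq => x y _ _ [].
have BY : B #= [set: Y] by apply: inj_card_eq => x y _ _ [].
have [|C [->|->] C_le] := @card_le_least_subset _ [set A; B].
- by exists A; left.
- by left; rewrite -(card_le_eql AX) -(card_le_eqr BY); apply: C_le; right.
- by right; rewrite -(card_le_eql BY) -(card_le_eqr AX); apply: C_le; left.
Qed.

Lemma least_card_exists (P : Type -> Prop) (X : Type) :
    (forall Y Z : Type, [set: Y] #= [set: Z] -> P Y -> P Z) -> P X ->
  exists Y : Type, least_card P Y.
Proof.
move=> Peq PX; pose Q (A : set X) := P A.
have [|A QA A_le] := @card_le_least_subset _ Q.
  by exists setT; apply: Peq PX; exact: card_setT_sym.
exists A; split=> // Y PY; rewrite (card_le_eql (card_setT A)).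
have [XY|YX] := card_le_total X Y.
  exact: card_le_trans (card_leT A) XY.
have [f f_inj] := card_leT_inj YX.
have YB : range f #= [set: Y] by apply: inj_card_eq => x y _ _ /f_inj.
rewrite -(card_le_eqr YB); apply: A_le; apply: Peq PY.
rewrite card_eq_sym; exact: card_eq_trans (card_setT _) YB.
Qed.

Lemma card_lt_powerset (X : Type) : card_lt X (set X).
Proof.
split.
  have : range (@set1 X) #= [set: X].
    by apply: inj_card_eq => x y _ _ /seteqP[xy _]; exact: xy.
  by move=> XX; rewrite -(card_le_eql XX); exact: card_leT.
move=> /card_leT_inj[f f_inj].
pose D : set X := [set x | exists2 A, f A = x & ~ A x].
have fD : D (f D) -> ~ D (f D).
  by move=> [A /f_inj AD]; rewrite AD.
have nD : ~ D (f D) by move=> Df; exact: (fD Df).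
by apply: (nD); exists D.
Qed.

Lemma card_lt_eqr (X Y Z : Type) :
  [set: Y] #= [set: Z] -> card_lt X Y -> card_lt X Z.
Proof.
by move=> YZ [XY nYX]; split; rewrite -?(card_le_eqr YZ) -?(card_le_eql YZ).
Qed.

Lemma card_succ_exists (X : Type) :
  exists Y : Type, least_card (card_lt X) Y.
Proof.
exact: least_card_exists (@card_lt_eqr X) (card_lt_powerset X).
Qed.

Definition card_succ (X : Type) : Type := projT1 (cid (card_succ_exists X)).

Lemma card_succP (X : Type) : least_card (card_lt X) (card_succ X).
Proof. exact: projT2 (cid (card_succ_exists X)). Qed.

Lemma card_sup_exists (F : nat -> Type) :
  exists Y : Type, least_card (fun Z => forall i, [set: F i] #<= [set: Z]) Y.
Proof.
apply: (@least_card_exists _ {i : nat & F i}) => [Y Z YZ FY i|i].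
  by rewrite -(card_le_eqr YZ).
have : range (existT F i) #= [set: F i].
  by apply: inj_card_eq => x y _ _; exact: eq_from_Tagged.
by move=> FF; rewrite -(card_le_eql FF); exact: card_leT.
Qed.

Definition card_sup (F : nat -> Type) : Type :=
  projT1 (cid (card_sup_exists F)).

Lemma card_supP (F : nat -> Type) :
  least_card (fun Z => forall i, [set: F i] #<= [set: Z]) (card_sup F).
Proof. exact: projT2 (cid (card_sup_exists F)). Qed.

(* card_succn X m is X^{+m}; card_succ_omega X is X^{+omega}, its supremum.      *)
Definition card_succn (X : Type) (m : nat) : Type := iter m card_succ X.

Definition card_succ_omega (X : Type) : Type := card_sup (card_succn X).

Definition homogeneous (T : finType) (c : {set T} -> bool) (H : {set T})
    (b : bool) : bool :=
  [forall e : {set T}, (e \subset H) && (#|e| == 2) ==> (c e == b)].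

(* A colouring is given on all subsets; only its values on pairs matter.        *)
Definition ramsey_arrow (l n : nat) : bool :=
  [forall c : {ffun {set 'I_n} -> bool}, exists H : {set 'I_n},
    (#|H| == l) && [exists b, homogeneous c H b]].

Lemma homogeneousU1 (T : finType) (c : {set T} -> bool) (x : T) (H : {set T}) b :
    homogeneous c H b -> (forall y, y \in H -> c [set x; y]%SET = b) ->
  homogeneous c (x |: H)%SET b.
Proof.
move=> /forallP hH hx; apply/forallP => e; apply/implyP => /andP[eH e2].
have [xe|xe] := boolP (x \in e); last first.
  apply: (implyP (hH e)); rewrite e2 andbT; apply/fintype.subsetP => y ye.
  have := fintype.subsetP eH y ye; rewrite !inE => /orP[/eqP yx|//].
  by rewrite -yx ye in xe.
move/cards2P: e2 => [y [z [yz ee]]].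
suff [w wH ->] : exists2 w, w \in H & e = [set x; w]%SET by rewrite hx.
have eH' w : w \in e -> w != x -> w \in H.
  by move=> we wx; have := fintype.subsetP eH w we; rewrite !inE (negbTE wx).
move: xe; rewrite ee !inE => /orP[] /eqP xE; subst x.
  by exists z => //; apply: eH'; rewrite ?ee ?inE ?eqxx ?orbT // eq_sym.
by exists y; rewrite 1?finset.setUC //; apply: eH'; rewrite ?ee ?inE ?eqxx.
Qed.

Lemma ramsey_two_colors (s t : nat) : exists N : nat,
  forall (T : finType) (c : {set T} -> bool) (A : {set T}), N <= #|A| ->
  exists2 H : {set T}, H \subset A &
    #|H| = s /\ homogeneous c H true \/ #|H| = t /\ homogeneous c H false.
Proof.
have hom0 (T : finType) (c : {set T} -> bool) b : homogeneous c finset.set0 b.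
  apply/forallP => e; apply/implyP; rewrite finset.subset0 => /andP[/eqP ->].
  by rewrite cards0.
elim: s t => [|s IHs] t.
  by exists 0 => T c A _; exists finset.set0; rewrite ?finset.sub0set ?cards0; auto.
elim: t => [|t [N2 IHt]].
  by exists 0 => T c A _; exists finset.set0; rewrite ?finset.sub0set ?cards0; auto.
have [N1 {}IHs] := IHs t.+1.
exists (N1 + N2).+1 => T c A leNA.
have /card_gt0P[x xA] : 0 < #|A| by exact: leq_trans leNA.
pose B b := [set y in (A :\ x)%SET | c [set x; y]%SET == b]%SET.
have BA b : B b \subset (A :\ x)%SET.
  by apply/fintype.subsetP => y; rewrite inE => /andP[].
have cardB : #|B true| + #|B false| = #|(A :\ x)%SET|.
  rewrite -(cardsID (B true) (A :\ x)%SET) (finset.setIidPr (BA true)).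
  congr (_ + _); apply: eq_card => y; rewrite !inE.
  by case: (c _); case: (_ == x); case: (y \in A).
have ext b (H : {set T}) k : H \subset B b -> #|H| = k -> homogeneous c H b ->
    [/\ (x |: H)%SET \subset A, #|(x |: H)%SET| = k.+1 &
        homogeneous c (x |: H)%SET b].
  move=> HB Hk Hh; have HA := fintype.subset_trans HB (BA b); split.
  - by rewrite finset.subUset finset.sub1set xA (fintype.subset_trans HA) ?finset.subsetDl.
  - rewrite cardsU1 Hk; suff -> : x \notin H by [].
    by apply/negP => /(fintype.subsetP HA); rewrite !inE eqxx.
  - apply: homogeneousU1 => // y /(fintype.subsetP HB).
    by rewrite inE => /andP[_ /eqP].
have BsubA b : B b \subset A by rewrite (fintype.subset_trans (BA b)) ?finset.subsetDl.
have [le1|lt1] := leqP N1 #|B true|.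
  have [H HB [[Hs Hh]|[Ht Hh]]] := IHs T c _ le1.
    have [] := ext _ _ _ HB Hs Hh => ? ? ?.
    by exists (x |: H)%SET => //; left.
  by exists H; [exact: fintype.subset_trans HB _|right].
have le2 : N2 <= #|B false|.
  rewrite -(leq_add2l N1); apply: (@leq_trans #|(A :\ x)%SET|).
    by rewrite -ltnS; apply: leq_trans leNA _; rewrite (cardsD1 x A) xA.
  by rewrite -cardB leq_add2r ltnW.
have [H HB [[Hs Hh]|[Ht Hh]]] := IHt T c _ le2.
  by exists H; [exact: fintype.subset_trans HB _|left].
have [] := ext _ _ _ HB Ht Hh => ? ? ?.
by exists (x |: H)%SET => //; right.
Qed.

Lemma ramsey_exists (l : nat) : exists n : nat, ramsey_arrow l n.
Proof.
have [N HN] := ramsey_two_colors l l; exists N.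
apply/forallP => c; have [|H _ Hl] := HN 'I_N c finset.setT.
  by rewrite cardsT card_ord.
apply/existsP; exists H; case: Hl => [[-> Hh]|[-> Hh]]; rewrite eqxx.
  by apply/existsP; exists true.
by apply/existsP; exists false.
Qed.

Definition ramsey (l : nat) : nat := ex_minn (ramsey_exists l).

Record simple_graph (V : Type) := SimpleGraph {
  adj : V -> V -> Prop;
  adj_sym : forall x y : V, adj x y -> adj y x;
  adj_irrefl : forall x : V, ~ adj x x }.

Definition npartite (V : Type) (G : simple_graph V) (n : nat)
    (U : 'I_n -> set V) : Prop :=
  [/\ \bigcup_i U i = setT, trivIset setT U &
      forall (i : 'I_n) (x y : V), U i x -> U i y -> ~ adj G x y].

(* Main.v *)
(* Let I be well-ordered in type kappa. The core is the polarized relation         *)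
(* (kappa^+, kappa^+) -> (kappa, kappa) for f on X x Y, valid for every infinite   *)
(* kappa, regular or singular, such that 2^lambda <= kappa for lambda < kappa.     *)
(* Assume that there is no kappa x kappa rectangle on which f fails. Cutting a set *)
(* S of size kappa into kappa pieces of size kappa shows that all but kappa points *)
(* y have kappa neighbours in S. As I has only kappa bounded subsets, one obtains  *)
(* sequences x : I -> X and y : I -> Y such that whenever the common neighbourhood *)
(* of a bounded piece of one sequence has size > kappa, it contains kappa points   *)
(* of the other sequence. Points u in X and v in Y avoiding kappa many sets of     *)
(* size kappa then guide the construction of a rectangle inside the two sequences: *)
(* all points chosen so far in Y are joined to u, so their common neighbourhood is *)
(* large, and kappa points of the sequence x lie in it and are joined to v.        *)
(* More parts are handled one at a time: if n parts are already homogeneous of     *)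
(* size kappa^+, each of the points of the last part (more than kappa^+ of them)   *)
(* is homogeneous to a subset of size kappa of a given part, and there are only    *)
(* (kappa^+)^kappa = kappa^+ such subsets. Finally Ramsey's theorem is applied to  *)
(* the colours of the pairs of parts.                                              *)
Require Import Defs.
From Stdlib Require Import Inverse_Image.
From mathcomp Require Import all_boot.
From mathcomp Require Import boolp classical_sets functions cardinality wochoice.

Set Implicit Arguments.
Unset Strict Implicit.
Unset Printing Implicit Defensive.

Local Open Scope classical_set_scope.
Local Open Scope card_scope.

(** Write k for the cardinality of [K]. It is enough to shrink all m+1 parts to sets of size k so
    that adjacency between any two of them is constant ([pairwise_homogeneous]): these constants
    colour the pairs of parts, and Ramsey's theorem yields l parts with a single colour.

    One successor cardinal is paid for each part beyond the first. For two parts of size k^+ this is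
    [polarized_partition]. For a further part, the earlier ones are made homogeneous at size k^+.
    Every point of the new part then sees one colour on k points of a given earlier part; only k^+
    outcomes exist, so more than k^+ points share one ([homogeneous_refinement]).

    In the two-part case, suppose every rectangle of size k by k contains an edge. Since 2^lambda <=
    k for lambda < k, an order of type k has only k bounded subsets, so sequences can be prepared
    that reflect every large common neighbourhood ([reflecting_sequences]). Generic points u and v
    ([generic_point]) guide the choice of a full rectangle inside these sequences: a bounded set of
    points joined to its guide has a large common neighbourhood, so the choice can always continue.
    [rectangle_of_extensions] needs only cofinality many steps, which also covers singular k. *)

(** * Comparing cardinalities through injections and surjections *)

Lemma card_le_of_inj (T U : Type) (A : set T) (B : set U) (f : T -> U) :
    (forall x, A x -> B (f x)) ->
    (forall x y, A x -> A y -> f x = f y -> x = y) ->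
  A #<= B.
Proof.
move=> fAB finj; have fA : f @` A #= A.
  by apply: inj_card_eq => x y; rewrite !inE => Ax Ay; exact: finj.
by rewrite -(card_le_eql fA); apply: subset_card_le => _ [x Ax <-]; exact: fAB.
Qed.

Lemma card_le_inj_on (T U : Type) (A : set T) (B : set U) (u0 : U) :
  A #<= B -> exists f : T -> U, (forall x, A x -> B (f x)) /\
    (forall x y, A x -> A y -> f x = f y -> x = y).
Proof.
move=> AB; have /card_leT_inj[g g_inj] : [set: A] #<= [set: B].
  by rewrite (card_le_eql (card_setT A)) (card_le_eqr (card_setT B)).
pose f x := if pselect (A x) is left Ax then val (g (SigSub (mem_set Ax))) else u0.
exists f; split=> [x Ax|x y Ax Ay]; rewrite /f.
  by case: pselect => // ?; exact: set_valP.
case: pselect => // ?; case: pselect => // ? /val_inj/g_inj.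
by move=> /(congr1 val).
Qed.

Lemma card_le_of_surj (T U : Type) (A : set T) (B : set U) (f : T -> U) :
  (forall y, B y -> exists2 x, A x & f x = y) -> B #<= A.
Proof.
by move=> fAB; apply: card_le_trans (card_image_le f A); exact: subset_card_le.
Qed.

Lemma card_le_total_set (T U : Type) (A : set T) (B : set U) :
  (A #<= B) \/ (B #<= A).
Proof.
have := card_le_total A B.
by rewrite (card_le_eql (card_setT A)) (card_le_eqr (card_setT B))
  (card_le_eql (card_setT B)) (card_le_eqr (card_setT A)).
Qed.

Lemma card_leNge (T U : Type) (A : set T) (B : set U) : ~ (A #<= B) -> B #<= A.
Proof. by have [] := card_le_total_set A B. Qed.

(** * Well-founded recursion and orders of initial type *)

(** Recursion along [R] with a choice at each stage. The second hypothesis says that the condition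
    at [i] looks only at values before [i]; [t0] merely fills in the other values. *)
Lemma wf_choice (I T : Type) (t0 : T) (R : I -> I -> Prop)
    (P : I -> (I -> T) -> T -> Prop) :
    well_founded R ->
    (forall i g g' t, (forall j, R j i -> g j = g' j) -> P i g t -> P i g' t) ->
    (forall i g, exists t, P i g t) ->
  exists h, forall i, P i h (h i).
Proof.
move=> Rwf Pext Pex.
pose C i g := projT1 (cid (Pex i g)).
have CP i g : P i g (C i g) by exact: projT2 (cid (Pex i g)).
pose ext i (rec : forall j, R j i -> T) j :=
  if pselect (R j i) is left ji then rec j ji else t0.
pose h := Fix Rwf (fun=> T) (fun i rec => C i (ext i rec)).
have hE i : h i = C i (ext i (fun j _ => h j)).
  rewrite /h Fix_eq// => k f g fg; congr (C k _); apply/funext => j.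
  by rewrite /ext; case: pselect.
exists h => i; rewrite hE; apply: Pext (CP i _) => j ji.
by rewrite /ext; case: pselect.
Qed.

Definition total_wf (I : Type) (R : I -> I -> Prop) : Prop :=
  [/\ well_founded R, forall i j k, R i j -> R j k -> R i k &
      forall i j, [\/ R i j, i = j | R j i]].

Definition segment (I : Type) (R : I -> I -> Prop) (i : I) : set I :=
  [set j | R j i].

(** The order type is an initial ordinal, that is, the cardinal of [I] itself. *)
Definition initial_order (I : Type) (R : I -> I -> Prop) : Prop :=
  total_wf R /\ forall i, ~ ([set: I] #<= segment R i).

Lemma wf_irrefl (I : Type) (R : I -> I -> Prop) i : well_founded R -> ~ R i i.
Proof. by move=> Rwf; elim/(well_founded_ind Rwf): i => i IHi Rii; exact: (IHi i Rii Rii). Qed.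

Lemma wf_min (I : Type) (R : I -> I -> Prop) (A : set I) :
  well_founded R -> A !=set0 -> exists2 i, A i & forall j, A j -> ~ R j i.
Proof.
move=> Rwf [i Ai]; apply: contrapT => nA; apply: (nA); exists i => // j Aj _.
elim/(well_founded_ind Rwf): j Aj => j IHj Aj; apply: nA; exists j => // k Ak kj.
exact: IHj kj Ak.
Qed.

Lemma total_wf_exists (T : Type) : exists R : T -> T -> Prop, total_wf R.
Proof.
have [R Rwo] := @well_ordering_principle {classic T}.
pose S (x y : T) := R x y /\ x <> y.
have Rwo2 (A : set T) : A !=set0 -> exists2 x, A x & forall y, A y -> R x y.
  move=> [a Aa]; have [|x [[/asboolP Ax xlb] _]] := Rwo (fun x => `[< A x >]).
    by exists a; exact/asboolP.
  by exists x => // y Ay; apply: xlb; exact/asboolP.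
have Rtot (x y : T) : R x y \/ R y x.
  have [|z [->|->] zlb] := Rwo2 [set x; y]; first by exists x; left.
    by left; apply: zlb; right.
  by right; apply: zlb; left.
have Ranti (x y : T) : R x y -> R y x -> x = y.
  move=> xy yx; have [|z [_ zuniq]] := Rwo (fun z => `[< z = x \/ z = y >]).
    by exists x; apply/asboolP; left.
  have RR w : R w w by have [] := Rtot w w.
  rewrite -(zuniq x) ?(zuniq y)//; split; do ?[by apply/asboolP; auto];
    by move=> w /asboolP[] ->.
have Rtrans (x y z : T) : R x y -> R y z -> R x z.
  move=> xy yz; have [|w ww wlb] := Rwo2 [set v | v = x \/ v = y \/ v = z].
    by exists x; left.
  have [wx wy wz] : [/\ R w x, R w y & R w z] by split; apply: wlb => /=; auto.
  case: ww => [<-//|[wE|wE]]; subst w.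
    by rewrite (Ranti _ _ xy wx).
  by rewrite (Ranti _ _ yz wy) in xy *.
exists S; split.
- move=> x; apply: contrapT => nx.
  have [|y ny ylb] := Rwo2 [set y | ~ Acc S y]; first by exists x.
  apply: ny; split=> z [zy zNy]; apply: contrapT => nz.
  exact/zNy/Ranti/ylb.
- move=> x y z [xy xNy] [yz yNz]; split; first exact: Rtrans yz.
  by move=> xz; subst z; exact/xNy/Ranti.
- move=> x y; have [->|xNy] := pselect (x = y); first by constructor 2.
  have [xy|yx] := Rtot x y; first by constructor 1.
  by constructor 3; split=> // yx'; exact: xNy.
Qed.

Lemma total_wf_inj (I J : Type) (R : J -> J -> Prop) (f : I -> J) :
  injective f -> total_wf R -> total_wf (fun i j => R (f i) (f j)).
Proof.
move=> finj [Rwf Rtr Rtot]; split.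
- exact: (wf_inverse_image I J R f Rwf).
- by move=> i j k; exact: Rtr.
- move=> i j; case: (Rtot (f i) (f j)) => [?|/finj ?|?].
  + by constructor 1.
  + by constructor 2.
  + by constructor 3.
Qed.

(** If some segment of a well-order is as large as [T], take the shortest one: pulling the order
    back along an injection of [T] into it embeds every new segment in a shorter, hence smaller,
    one. *)
Lemma initial_order_exists (T : Type) :
  exists R : T -> T -> Prop, initial_order R.
Proof.
have [R Rtwf] := total_wf_exists T; have [Rwf _ _] := Rtwf.
have [/(wf_min Rwf)|R0] := pselect ([set t | [set: T] #<= segment R t] !=set0);
    last first.
  by exists R; split=> // i Ti; apply: R0; exists i.
move=> [t tT tmin]; have [g [gR ginj]] := card_le_inj_on t tT.
have g_inj : injective g by move=> x y; exact: ginj.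
exists (fun x y => R (g x) (g y)); split; first exact: total_wf_inj.
move=> i Ti; apply: (tmin (g i)); last exact: gR.
apply: card_le_trans Ti _.
by apply: (@card_le_of_inj _ _ _ _ g) => // x y _ _; exact: g_inj.
Qed.

(** Each [p] is sent to an element of [B] not yet used; one remains, since no segment can be mapped
    onto [B]. *)
Lemma card_le_total_wf (P U : Type) (R : P -> P -> Prop) (B : set U) :
  total_wf R -> (forall p, ~ (B #<= segment R p)) -> [set: P] #<= B.
Proof.
move=> [Rwf _ Rtot] RB.
have [p|/forallNP P0] := pselect (exists p : P, True); last first.
  suff -> : [set: P] = set0 by exact: card_ge0.
  by apply/seteqP; split=> // p _; apply: (P0 p).
have ex (i : P) (g : P -> U) : exists t, B t /\ forall j, R j i -> g j <> t.
  apply: contrapT => /forallNP nt; apply: (RB i).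
  apply: (@card_le_of_surj _ _ _ _ g) => t Bt; apply: contrapT => nj.
  by apply: (nt t); split=> // j ji gj; apply: nj; exists j.
have [t0 _] : B !=set0.
  by case: p => p _; apply: contrapT => /nonemptyPn B0; apply: (RB p); rewrite B0.
have [|h hP] := @wf_choice P U t0 R
    (fun i g t => B t /\ forall j, R j i -> g j <> t) Rwf _ ex.
  by move=> i g g' t gg' [Bt gt]; split=> // j ji; rewrite -gg'//; exact: gt.
apply: (@card_le_of_inj _ _ _ _ h) => [x _|x y _ _ hxy]; first by case: (hP x).
case: (Rtot x y) => // [xy|yx]; first by case: ((hP y).2 x xy).
by case: ((hP x).2 y yx).
Qed.

Lemma mono_enum (I : Type) (R : I -> I -> Prop) (Q : set I) :
    initial_order R -> [set: I] #<= Q ->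
  exists f : I -> I, (forall k, Q (f k)) /\ forall j k, R j k -> R (f j) (f k).
Proof.
move=> [[Rwf Rtr Rtot] RI] IQ.
have [i0|/forallNP P0] := pselect (exists i : I, True); last first.
  by exists id; split=> [k|j]; [case: (P0 k)|case: (P0 j)].
case: i0 => i0 _.
pose free i (g : I -> I) t := Q t /\ forall j, R j i -> g j <> t.
pose P i g t := free i g t /\ forall s, free i g s -> ~ R s t.
have ex (i : I) (g : I -> I) : exists t, P i g t.
  have [|t Qt tmin] := @wf_min _ R (free i g) Rwf; last by exists t.
  apply: contrapT => /forallNP nt; apply: (RI i); apply: card_le_trans IQ _.
  apply: (@card_le_of_surj _ _ _ _ g) => t Qt; apply: contrapT => nj.
  by apply: (nt t); split=> // j ji gj; apply: nj; exists j.
have freeE i (g g' : I -> I) t : (forall j, R j i -> g j = g' j) -> free i g t -> free i g' t.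
  by move=> gg' [Qt gt]; split=> // j ji; rewrite -gg'//; exact: gt.
have [|h hP] := @wf_choice I I i0 R P Rwf _ ex.
  move=> i g g' t gg' [gt tmin]; split; first exact: freeE gt.
  by move=> s gs; apply: tmin; apply: freeE gs => j /gg'.
exists h; split=> [k|j k jk]; first by case: (hP k) => -[].
have [[Qk hk] _] := hP k; have [_ minj] := hP j.
case: (Rtot (h j) (h k)) => // [/(hk _ jk)//|kj].
by case: (minj (h k)) => //; split=> // l lj; apply: hk; exact: Rtr jk.
Qed.

(** * Arithmetic of infinite cardinals *)

(** Hilbert's hotel: [a] is put at the start of a copy of the natural numbers inside [A], which is
    shifted by one. *)
Lemma card_le_setU1 (T : Type) (A : set T) (a : T) :
  infinite_set A -> A `|` [set a] #<= A.
Proof.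
move=> /infiniteP/(card_le_inj_on a)[g [gA ginj]].
have [Aa|nAa] := pselect (A a).
  by apply: subset_card_le => x [|->].
pose f x := if pselect (exists n, g n = x) is left e then g (projT1 (cid e)).+1
  else if pselect (x = a) is left _ then g 0 else x.
have fg n : f (g n) = g n.+1.
  rewrite /f; case: pselect => [e|[]]; last by exists n.
  by case: cid => m /= /ginj ->.
have fa : f a = g 0.
  rewrite /f; case: pselect => [[n ga]|_]; first by case: nAa; rewrite -ga; exact: gA.
  by case: pselect.
have fN x : (~ exists n, g n = x) -> x <> a -> f x = x.
  by rewrite /f => gx xa; case: pselect => // _; case: pselect.
have cases x : (A `|` [set a]) x -> [\/ x = a, exists n, x = g n |
    [/\ A x, f x = x & ~ exists n, g n = x]].
  move=> Ax; have [->|xa] := pselect (x = a); first by constructor 1.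
  have [[n <-]|gx] := pselect (exists n, g n = x); first by constructor 2; exists n.
  by constructor 3; split=> //; [case: Ax|exact: fN].
apply: (@card_le_of_inj _ _ _ _ f).
  move=> x /cases[->|[n ->]|[Ax -> _]]//; rewrite ?fa ?fg; exact: gA.
move=> x y /cases[->|[n ->]|[Ax xE gx]] /cases[->|[m ->]|[Ay yE gy]] //;
  rewrite ?fa ?fg ?xE ?yE //.
- by move=> /ginj-/(_ I I).
- by move=> yg; case: gy; exists 0.
- by move=> /ginj-/(_ I I).
- by move=> /ginj-/(_ I I)[->].
- by move=> yg; case: gy; exists n.+1.
- by move=> xg; case: gx; exists 0.
- by move=> xg; case: gx; exists m.+1.
Qed.

Lemma card_leX (T U T' U' : Type) (A : set T) (B : set U) (A' : set T')
    (B' : set U') :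
  A #<= A' -> B #<= B' -> A `*` B #<= A' `*` B'.
Proof.
move=> AA' BB'; have [[[a b] [/= Aa Bb]]|N] := pselect (A `*` B !=set0); last first.
  rewrite (_ : A `*` B = set0); first exact: card_ge0.
  by apply/seteqP; split=> // p ABp; case: N; exists p.
have inhab (V W : Type) (C : set V) (D : set W) c : C c -> C #<= D -> inhabited W.
  move=> Cc CD; apply: contrapT => nW; suff C0 : C = set0 by rewrite C0 in Cc.
  apply/eqP; rewrite -(card_le0 W); suff <- : D = set0 by [].
  by apply/seteqP; split=> // w _; apply: nW.
have [[t0] [u0]] := (inhab _ _ _ _ _ Aa AA', inhab _ _ _ _ _ Bb BB').
have [f [fA finj]] := card_le_inj_on t0 AA'.
have [g [gB ginj]] := card_le_inj_on u0 BB'.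
apply: (@card_le_of_inj _ _ _ _ (fun p => (f p.1, g p.2))).
  by move=> [x y] [/= Ax By]; split; [exact: fA|exact: gB].
by move=> [x y] [x' y'] [/= Ax By] [/= Ax' By'] [/finj-> // /ginj->].
Qed.

Lemma total_wf_lex (I J : Type) (R : I -> I -> Prop) (S : J -> J -> Prop) :
    total_wf R -> total_wf S ->
  total_wf (fun p q : I * J => R p.1 q.1 \/ p.1 = q.1 /\ S p.2 q.2).
Proof.
move=> [Rwf Rtr Rtot] [Swf Str Stot]; split.
- move=> [i j]; elim/(well_founded_ind Rwf): i j => i IHi j.
  elim/(well_founded_ind Swf): j => j IHj; split=> -[i' j'] /= [ii'|[-> jj']].
    exact: IHi.
  exact: IHj.
- move=> [i j] [i' j'] [i'' j''] /= [ii|[-> jj]] [ii'|[<- jj']]; last 1 first.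
  + by right; split=> //; exact: Str jj'.
  + by left; exact: Rtr ii'.
  + by left.
  + by left.
- move=> [i j] [i' j'] /=; case: (Rtot i i') => [?|->|?].
  + by constructor 1; left.
  + case: (Stot j j') => [?|->|?].
    * by constructor 1; right.
    * by constructor 2.
    * by constructor 3; right.
  + by constructor 3; left.
Qed.

(* The pairs are ordered by their maximum, then lexicographically; the pairs   *)
(* below p form a subset of D x D, where D is the set of points up to max p.   *)
Lemma card_le_prod (T : Type) :
  infinite_set [set: T] -> [set: T * T] #<= [set: T].
Proof.
move=> infT; apply: contrapT => nT.
pose P Y := infinite_set [set: Y] /\ ~ ([set: Y * Y] #<= [set: Y]).
have [||Y [[infY nY] Ymin]] := @least_card_exists P T; last 1 first.
- have [R [Rtwf RY]] := initial_order_exists Y; have [Rwf Rtr Rtot] := Rtwf.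
  pose mx (p : Y * Y) := if pselect (R p.1 p.2) then p.2 else p.1.
  pose key p := (mx p, p).
  have key_inj : injective key by move=> p q [].
  have Gtwf := total_wf_inj key_inj (total_wf_lex Rtwf (total_wf_lex Rtwf Rtwf)).
  apply: nY; apply: (card_le_total_wf Gtwf) => p.
  pose D := segment R (mx p) `|` [set mx p].
  have YD : ~ ([set: Y] #<= D).
    have [finD|infD] := pselect (finite_set (segment R (mx p))).
      move=> /card_le_finite YD; apply/infY/YD; by rewrite finite_setU.
    by move=> YD; apply: (RY (mx p)); exact: card_le_trans YD (card_le_setU1 _ infD).
  have mxP q : ~ R (mx q) q.1 /\ ~ R (mx q) q.2.
    rewrite /mx; case: pselect => [q12|nq12]; split=> //.
    - by move=> q21; exact: (wf_irrefl Rwf (Rtr _ _ _ q12 q21)).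
    - exact: wf_irrefl.
    - exact: wf_irrefl.
  have DP x y : ~ R y x -> R y (mx p) \/ y = mx p -> D x.
    move=> nyx; case: (Rtot x y) => [xy|->|//] [yp|yp].
    - by left; exact: Rtr yp.
    - by left; rewrite /segment /= -yp.
    - by left.
    - by right.
  move=> Yp; have YDD : [set: Y] #<= D `*` D.
    apply: card_le_trans Yp _; apply: subset_card_le => q qp.
    have mq : R (mx q) (mx p) \/ mx q = mx p by case: qp => [|[]]; auto.
    by have [q1 q2] := mxP q; split; apply: DP mq.
  have [finD|infD] := pselect (finite_set D).
    by apply: infY; apply: card_le_finite YDD _; exact: finite_setX.
  (* [Y] is a least counterexample and [D] is infinite and smaller, so [D] absorbs its own
     square. *)
  apply: YD; have [/Ymin|nPD] := pselect (P {y | y \in D}).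
    by rewrite (card_le_eqr (card_setT D)).
  have DE := card_setT D.
  have DD : [set: D * D] #<= [set: D].
    apply: contrapT => nD; apply: nPD; split=> //.
    by move=> fD; apply: infD; rewrite -(eq_finite_set DE).
  apply: card_le_trans YDD _; rewrite -(card_le_eqr DE).
  apply: card_le_trans DD; rewrite -setXTT.
  by apply: card_leX; rewrite (card_le_eqr DE).
- move=> Y Z YZ [infY nY]; split; first by rewrite -(eq_finite_set YZ).
  move=> ZZ; apply: nY; rewrite (card_le_eqr YZ); apply: card_le_trans ZZ.
  by rewrite -!setXTT; apply: card_leX; rewrite -(card_le_eqr YZ).
- by [].
Qed.

Lemma card_le_setX (T U J : Type) (A : set T) (B : set U) :
    infinite_set [set: J] -> A #<= [set: J] -> B #<= [set: J] ->
  A `*` B #<= [set: J].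
Proof.
move=> /card_le_prod JJ AJ BJ; apply: card_le_trans JJ.
by rewrite -setXTT; exact: card_leX.
Qed.

Lemma card_le_bigcup (T D J : Type) (A : set D) (F : D -> set T) :
    infinite_set [set: J] -> A #<= [set: J] ->
    (forall d, A d -> F d #<= [set: J]) ->
  \bigcup_(d in A) F d #<= [set: J].
Proof.
move=> infJ AJ FJ; have [j0 _] := infinite_setN0 infJ.
have [x|/forallNP N] := pselect (exists x, (\bigcup_(d in A) F d) x); last first.
  rewrite (_ : \bigcup_(d in A) F d = set0); first exact: card_ge0.
  by apply/seteqP; split=> // x /N.
case: x => x0 [d0 Ad0 _].
have fP d : exists f : T -> J, A d -> forall x y, F d x -> F d y -> f x = f y -> x = y.
  have [Ad|nAd] := pselect (A d); last by exists (fun=> j0).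
  by have [f [_ finj]] := card_le_inj_on j0 (FJ d Ad); exists f.
have [f finj] := choice fP.
have dP x : exists d, (\bigcup_(d in A) F d) x -> A d /\ F d x.
  by have [[d]|?] := pselect ((\bigcup_(d in A) F d) x); [exists d|exists d0].
have [d dE] := choice dP.
apply: card_le_trans (@card_le_setX _ _ J A [set: J] infJ AJ (card_lexx _)).
apply: (@card_le_of_inj _ _ _ _ (fun x => (d x, f (d x) x))) => [x /dE[]//|].
move=> x y /dE[Adx Fx] /dE[Ady Fy] [dxy]; rewrite dxy in Fx *.
exact: finj.
Qed.

Lemma card_le_setU (T J : Type) (A B : set T) :
    infinite_set [set: J] -> A #<= [set: J] -> B #<= [set: J] ->
  A `|` B #<= [set: J].
Proof.
move=> infJ AJ BJ.
suff -> : A `|` B = \bigcup_(b in [set: bool]) (if b then A else B).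
  apply: card_le_bigcup => // [|[]//].
  by apply: card_le_trans (countableP _) _; exact/infiniteP.
apply/seteqP; split=> [x [Ax|Bx]|x [[] _ ?]]; [by exists true|by exists false|by left|by right].
Qed.

(** The larger of the two sets absorbs the smaller one. *)
Lemma card_le_setU_or (T J : Type) (A B : set T) :
    infinite_set [set: J] -> [set: J] #<= A `|` B ->
  [set: J] #<= A \/ [set: J] #<= B.
Proof.
move=> infJ.
suff wl (C D : set T) : C #<= D -> [set: J] #<= C `|` D -> [set: J] #<= D.
  have [AB|BA] := card_le_total_set A B; first by move=> /(wl _ _ AB); right.
  by rewrite setUC => /(wl _ _ BA); left.
move=> CD JCD; have infD : infinite_set D.
  move=> finD; apply: infJ; apply: card_le_finite JCD _.
  by rewrite finite_setU; split=> //; exact: card_le_finite CD finD.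
apply: card_le_trans JCD _; rewrite -(card_le_eqr (card_setT D)).
apply: card_le_setU; rewrite ?(card_le_eqr (card_setT D))//.
by move=> fD; apply: infD; rewrite -(eq_finite_set (card_setT D)).
Qed.

Lemma card_le_pigeonhole (T D J : Type) (A : set T) (f : T -> D) :
    infinite_set [set: J] -> ~ (A #<= [set: J]) -> f @` A #<= [set: J] ->
  exists d, ~ (A `&` f @^-1` [set d] #<= [set: J]).
Proof.
move=> infJ AJ fJ; apply: contrapT => /forallNP nd; apply: AJ.
apply: (@card_le_trans _ _ _ (\bigcup_(d in f @` A) (A `&` f @^-1` [set d]))).
  by apply: subset_card_le => x Ax; exists (f x) => //; exists x.
by apply: card_le_bigcup => // d _; apply: contrapT; exact: nd.
Qed.

Lemma finite_setT_set (T : Type) :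
  finite_set [set: T] -> finite_set [set: set T].
Proof.
move=> [n /card_esym/card_eqPle[nT Tn]].
have [f finj] : exists f : T -> 'I_n, injective f.
  by apply: card_leT_inj; rewrite -(card_le_eqr card_II).
apply: (@card_le_finite _ _ _ [set: {set 'I_n}]); last exact: finite_finset.
apply: (@card_le_of_inj _ _ _ _ (fun A => [set i | `[< (f @` A) i >]]%SET)) => //.
move=> A B _ _ /setP AB; have AB' x : (f @` A) x <-> (f @` B) x.
  have := AB x; rewrite !inE => ABx.
  by split=> /asboolP Fx; apply/asboolP; [rewrite -ABx|rewrite ABx].
apply/seteqP; split=> x Ax.
  by have /AB'[y By /finj <-] : (f @` A) (f x) by exists x.
by have /AB'[y By /finj <-] : (f @` B) (f x) by exists x.
Qed.

(** * Bounded subsets of an initial order, and small exceptional sets *)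

Lemma segmentC_card (I : Type) (R : I -> I -> Prop) i :
    infinite_set [set: I] -> initial_order R ->
  ~ ([set: I] #<= [set k | ~ R i k]).
Proof.
move=> infI [[Rwf Rtr Rtot] RI] Ii.
have [||] := @card_le_setU_or I I (segment R i) [set i] infI; last 2 first.
- exact: RI.
- by move=> /card_le_finite fI; exact/infI/fI.
apply: card_le_trans Ii _; apply: subset_card_le => k nik.
by case: (Rtot i k) => [//|->|ki]; [right|left].
Qed.

Lemma unbounded_of_card (I : Type) (R : I -> I -> Prop) (Q : set I) i :
    infinite_set [set: I] -> initial_order R -> [set: I] #<= Q ->
  exists2 k, Q k & R i k.
Proof.
move=> infI RI IQ; apply: contrapT => nk; apply: (segmentC_card infI RI (i := i)).
apply: card_le_trans IQ _; apply: subset_card_le => k Qk ik.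
by apply: nk; exists k.
Qed.

Lemma card_setD_bounded (I : Type) (R : I -> I -> Prop) (Q b : set I) i :
    infinite_set [set: I] -> initial_order R -> [set: I] #<= Q ->
    b `<=` segment R i ->
  [set: I] #<= Q `\` b.
Proof.
move=> infI [_ RI] IQ bi.
have [|//|Ib] := @card_le_setU_or I I (Q `\` b) b infI.
  apply: card_le_trans IQ _; apply: subset_card_le => x Qx.
  by have [bx|nbx] := pselect (b x); [right|left].
by case: (RI i); apply: card_le_trans Ib _; exact: subset_card_le.
Qed.

Definition bounded_subset (I : Type) (R : I -> I -> Prop) : set (set I) :=
  [set b | exists i, b `<=` segment R i].

Lemma bounded_subset_card (I : Type) (R : I -> I -> Prop) :
    infinite_set [set: I] -> initial_order R ->
    (forall L : Type, ~ ([set: I] #<= [set: L]) -> [set: set L] #<= [set: I]) ->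
  bounded_subset R #<= [set: I].
Proof.
move=> infI [_ RI] powI.
rewrite (_ : bounded_subset R =
    \bigcup_(i in [set: I]) [set b | b `<=` segment R i]); last first.
  by apply/seteqP; split=> [b [i bi]|b [i _ bi]]; exists i.
apply: card_le_bigcup => // i _.
have := powI (segment R i); rewrite (card_le_eqr (card_setT _)) => /(_ (RI i)).
apply: card_le_trans.
apply: (@card_le_of_inj _ _ _ _ (fun b => [set u : segment R i | b (val u)])) => //.
move=> b b' bi b'i bb'; have bbE (u : segment R i) : b (val u) = b' (val u).
  exact: (congr1 (fun s : set (segment R i) => s u) bb').
apply/seteqP; split=> x bx.
  by have := bbE (SigSub (mem_set (bi _ bx))) => /= <-.
by have := bbE (SigSub (mem_set (b'i _ bx))) => /= ->.
Qed.

(** A list of all bounded sets, each repeated [I] many times beyond any of its bounds: [t] inverts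
    an injection of pairs (bounded set, index) into [I]. *)
Lemma bounded_subset_enum (I : Type) (R : I -> I -> Prop) :
    infinite_set [set: I] -> initial_order R ->
    (forall L : Type, ~ ([set: I] #<= [set: L]) -> [set: set L] #<= [set: I]) ->
  exists t : I -> set I, forall i b, b `<=` segment R i ->
    [set: I] #<= [set k | t k = b /\ R i k].
Proof.
move=> infI RI powI; have [i0 _] := infinite_setN0 infI.
have := card_le_setX infI (bounded_subset_card infI RI powI) (card_lexx [set: I]).
move=> /(card_le_inj_on i0)[g [_ ginj]].
pose B := bounded_subset R `*` [set: I].
pose t k := if pselect (exists p, B p /\ g p = k) is left e
  then (projT1 (cid e)).1 else set0.
exists t => i b bi; have Bb k : B (b, k) by split=> //; exists i.
have tE k : t (g (b, k)) = b.
  rewrite /t; case: pselect => [e|[]]; last by exists (b, k).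
  by case: cid => p [Bp gp] /=; rewrite (ginj p (b, k) Bp (Bb k) gp).
have [|//|] := @card_le_setU_or I I [set k | t k = b /\ R i k] [set k | ~ R i k] infI.
  apply: (@card_le_of_inj _ _ _ _ (fun k => g (b, k))) => [k _|k l _ _].
    by have [ik|nik] := pselect (R i (g (b, k))); [left|right].
  by move=> /ginj-/(_ (Bb k) (Bb l))[].
by move=> /(segmentC_card infI RI).
Qed.

(* S is cut into J many pieces of size J; fewer than J points are joined to no   *)
(* element of a given piece, and all the other points have a neighbour in every  *)
(* piece.                                                                        *)
Lemma few_exceptions (X Y J : Type) (f : X -> Y -> Prop) (S : set X) :
    infinite_set [set: J] ->
    (forall A B, [set: J] #<= A -> [set: J] #<= B ->
       exists a b, [/\ A a, B b & f a b]) ->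
    [set: J] #<= S ->
  [set y | ~ ([set: J] #<= S `&` [set x | f x y])] #<= [set: J].
Proof.
move=> infJ fP JS; have [j0 _] := infinite_setN0 infJ.
have JJ := card_le_prod infJ.
have [x0 Sx0] : S !=set0.
  by apply/set0P/eqP => S0; move: JS; rewrite S0 card_le0 => /eqP J0;
    have : [set: J] j0 by []; rewrite J0.
have [e [eS einj]] := card_le_inj_on x0 (card_le_trans JJ JS).
pose N i := [set y | forall j, ~ f (e (i, j)) y].
apply: (@card_le_trans _ _ _ (\bigcup_(i in [set: J]) N i)); last first.
  apply: card_le_bigcup => // i _; apply: card_leNge => JN.
  have [|_ [y [[j _ <-] Ny]]] := fP (range (fun j => e (i, j))) (N i) _ JN.
    apply: (@card_le_of_inj _ _ _ _ (fun j => e (i, j))) => [j _|j k _ _].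
      by exists j.
    by move=> /einj-/(_ I I)[].
  exact: Ny.
apply: subset_card_le => y /= ny; apply: contrapT => nN; apply: ny.
have jP i : exists j, f (e (i, j)) y.
  by apply: contrapT => /forallNP fN; apply: nN; exists i.
have [j jE] := choice jP.
apply: (@card_le_of_inj _ _ _ _ (fun i => e (i, j i))) => [i _|i k _ _].
  by split; [exact: eS|exact: jE].
by move=> /einj-/(_ I I)[].
Qed.

(** * The polarized partition relation *)

Lemma fresh_element (T I : Type) (A : set T) (g : I -> T) :
  ~ (A #<= [set: I]) -> exists2 a, A a & forall i, g i <> a.
Proof.
move=> AI; apply: contrapT => na; apply: AI.
apply: (@card_le_of_surj _ _ _ _ g) => a Aa; apply: contrapT => ni.
by apply: na; exists a => // i gi; apply: ni; exists i.
Qed.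

(** Stage [k] treats the set [t k]: new points [x k] and [y k] are taken, inside the common
    neighbourhood of the opposite points indexed by [t k] whenever it is larger than [I]. Every
    bounded set is treated at [I] many stages beyond it. *)
Lemma reflecting_sequences (X Y I : Type) (R : I -> I -> Prop)
    (f : X -> Y -> Prop) :
    infinite_set [set: I] -> initial_order R ->
    (forall L : Type, ~ ([set: I] #<= [set: L]) -> [set: set L] #<= [set: I]) ->
    ~ ([set: X] #<= [set: I]) -> ~ ([set: Y] #<= [set: I]) ->
  exists (x : I -> X) (y : I -> Y),
    [/\ injective x, injective y,
        forall b, bounded_subset R b ->
          ~ ([set u | forall j, b j -> f u (y j)] #<= [set: I]) ->
          [set: I] #<= [set k | forall j, b j -> f (x k) (y j)] &
        forall b, bounded_subset R b ->
          ~ ([set v | forall j, b j -> f (x j) v] #<= [set: I]) ->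
          [set: I] #<= [set k | forall j, b j -> f (x j) (y k)]].
Proof.
move=> infI RI powI XI YI.
have [t tP] := bounded_subset_enum infI RI powI.
have [[Rwf Rtr Rtot] _] := RI.
(* The guard [R j k] makes stage [k] depend on earlier values only; it excludes nothing when [t k]
   lies below [k]. *)
pose U k (g : I -> X * Y) := [set u | forall j, t k j -> R j k -> f u (g j).2].
pose V k (g : I -> X * Y) := [set v | forall j, t k j -> R j k -> f (g j).1 v].
pose P k (g : I -> X * Y) (w : X * Y) :=
  [/\ forall j, R j k -> (g j).1 <> w.1 /\ (g j).2 <> w.2,
      ~ (U k g #<= [set: I]) -> U k g w.1 & ~ (V k g #<= [set: I]) -> V k g w.2].
have exg (T : Type) (A : set T) (g : I -> T) : ~ ([set: T] #<= [set: I]) ->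
    exists a, (forall i, g i <> a) /\ (~ (A #<= [set: I]) -> A a).
  move=> TI; have [AI|AI] := pselect (A #<= [set: I]).
    by have [a _ ga] := fresh_element g TI; exists a.
  by have [a Aa ga] := fresh_element g AI; exists a.
have inhab (T : Type) : ~ ([set: T] #<= [set: I]) -> inhabited T.
  move=> TI; apply: contrapT => nT; apply: TI.
  rewrite (_ : [set: T] = set0); first exact: card_ge0.
  by apply/seteqP; split=> // u _; apply: nT.
have [[x0] [y0]] := (inhab _ XI, inhab _ YI).
have [|k g|h hP] := @wf_choice I (X * Y) (x0, y0) R P Rwf.
- move=> k g g' w gg'; rewrite /P.
  have -> : U k g = U k g'.
    by apply/seteqP; split=> u Uu j kj jk; have := Uu j kj jk; rewrite gg'.
  have -> : V k g = V k g'.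
    by apply/seteqP; split=> u Uu j kj jk; have := Uu j kj jk; rewrite gg'.
  by case=> gw Uw Vw; split=> // j jk; rewrite -gg'//; exact: gw.
- have [a [ga Ua]] := exg X (U k g) (fun j => (g j).1) XI.
  have [b [gb Vb]] := exg Y (V k g) (fun j => (g j).2) YI.
  by exists (a, b).
exists (fun k => (h k).1), (fun k => (h k).2); split.
- move=> i j ij; case: (Rtot i j) => // [lt|lt].
    by have [/(_ i lt)[+ _]] := hP j; rewrite ij.
  by have [/(_ j lt)[+ _]] := hP i; rewrite ij.
- move=> i j ij; case: (Rtot i j) => // [lt|lt].
    by have [/(_ i lt)[_ +]] := hP j; rewrite ij.
  by have [/(_ j lt)[_ +]] := hP i; rewrite ij.
- move=> b [i bi] bI; apply: card_le_trans (tP i b bi) _.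
  apply: subset_card_le => k [tk ik] j bj; have [_ + _] := hP k.
  apply; [|by rewrite tk|exact: Rtr (bi j bj) ik].
  move=> UI; apply: bI; apply: card_le_trans UI; apply: subset_card_le => u ub l.
  by rewrite tk => bl _; exact: ub.
- move=> b [i bi] bI; apply: card_le_trans (tP i b bi) _.
  apply: subset_card_le => k [tk ik] j bj; have [_ _ +] := hP k.
  apply; [|by rewrite tk|exact: Rtr (bi j bj) ik].
  move=> VI; apply: bI; apply: card_le_trans VI; apply: subset_card_le => u ub l.
  by rewrite tk => bl _; exact: ub.
Qed.

(** Each bounded [b] forbids at most [I] many points: [E1 b] by [few_exceptions], and [E2 b] because
    it is empty unless [V b] is small. With only [I] many sets [b], some [v] is never forbidden. *)
Lemma generic_point (X Y I : Type) (R : I -> I -> Prop) (f : X -> Y -> Prop)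
    (x : I -> X) (y : I -> Y) :
    infinite_set [set: I] -> bounded_subset R #<= [set: I] ->
    ~ ([set: Y] #<= [set: I]) -> injective x ->
    (forall A B, [set: I] #<= A -> [set: I] #<= B ->
       exists a b, [/\ A a, B b & f a b]) ->
  exists v, forall b, bounded_subset R b ->
    ([set: I] #<= [set k | forall j, b j -> f (x k) (y j)] ->
     [set: I] #<= [set k | f (x k) v /\ forall j, b j -> f (x k) (y j)]) /\
    ((forall j, b j -> f (x j) v) ->
     ~ ([set w | forall j, b j -> f (x j) w] #<= [set: I])).
Proof.
move=> infI BI YI xinj fP.
pose K b := [set k | forall j, b j -> f (x k) (y j)].
pose V b := [set w | forall j, b j -> f (x j) w].
pose E1 b := [set v | [set: I] #<= K b /\ ~ ([set: I] #<= K b `&` [set k | f (x k) v])].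
pose E2 b := [set v | V b v /\ V b #<= [set: I]].
have EI : ~ ([set: Y] #<= \bigcup_(b in bounded_subset R) (E1 b `|` E2 b)).
  move=> YE; apply: YI; apply: card_le_trans YE _.
  apply: card_le_bigcup => // b _; apply: card_le_setU => //.
    have [IK|nIK] := pselect ([set: I] #<= K b).
      apply: card_le_trans (@few_exceptions I Y I (fun k => f (x k)) _ infI _ IK).
        by apply: subset_card_le => v [].
      move=> A B IA IB; have [|_ [w [[a Aa <-] Bw faw]]] := fP (x @` A) B _ IB.
        apply: card_le_trans IA _; apply: (@card_le_of_inj _ _ _ _ x) => [a|a a' _ _].
          by exists a.
        exact: xinj.
      by exists a, w.
    rewrite (_ : E1 b = set0); first exact: card_ge0.
    by apply/seteqP; split=> // v [].
  have [VI|nVI] := pselect (V b #<= [set: I]).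
    by apply: card_le_trans VI; apply: subset_card_le => v [].
  rewrite (_ : E2 b = set0); first exact: card_ge0.
  by apply/seteqP; split=> // v [].
have [v nEv] : exists v, ~ (\bigcup_(b in bounded_subset R) (E1 b `|` E2 b)) v.
  apply: contrapT => /forallNP Ev; apply: EI; apply: subset_card_le => v _.
  exact: contrapT (Ev v).
exists v => b Bb; split=> [IK|bv VI]; last first.
  by apply: nEv; exists b => //; right.
rewrite [X in _ #<= X](_ : _ = K b `&` [set k | f (x k) v]); last first.
  by apply/seteqP; split=> k [].
by apply: contrapT => nI; apply: nEv; exists b => //; left.
Qed.

Lemma cofinal_order (I : Type) (R : I -> I -> Prop) :
    infinite_set [set: I] -> initial_order R ->
  exists (C : Type) (c : C -> I) (S : C -> C -> Prop),
    [/\ total_wf S, forall k, exists i, R k (c i) &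
        forall i (h : C -> I), exists k, forall j, S j i -> R (h j) k].
Proof.
move=> infI RI; have [[Rwf Rtr Rtot] _] := RI.
(* A cofinal set of least cardinality, well-ordered in order type that cardinal: *)
(* its proper segments are too small to be mapped onto a cofinal set.            *)
pose Q : set (set I) := [set A | forall k, exists2 i, A i & R k i].
have sP k : exists k', R k k'.
  by have [k' _ kk'] := unbounded_of_card k infI RI (card_lexx _); exists k'.
have [s sE] := choice sP.
have [|A QA Amin] := @card_le_least_subset I Q.
  by exists setT => k; exists (s k).
have [S [Stwf SA]] := initial_order_exists A.
exists A, (fun i => val i), S; split=> // [k|i h].
  by have [i Ai ki] := QA k; exists (SigSub (mem_set Ai)).
apply: contrapT => /forallNP nk; apply: (SA i).
rewrite (card_le_eql (card_setT A)).
apply: card_le_trans (card_image_le (fun j => s (h j)) (segment S i)).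
apply: Amin => k; have /existsNP[j /not_implyP[ji hj]] := nk k.
(* Unboundedness only says that [h j] is not below [k]; a point strictly above [h j] is strictly
   above [k]. *)
exists (s (h j)); first by exists j.
by case: (Rtot (h j) k) => // [<-|kh]; [exact: sE|exact: Rtr (sE _)].
Qed.

(* Limit steps require the union of the earlier blocks to be bounded, so the     *)
(* rectangle is built in cf(I) steps only; for singular I, it reaches the size of *)
(* I because step i adds as many points to each side as there are below c i.      *)
Lemma rectangle_of_extensions (I : Type) (R : I -> I -> Prop)
    (F : I -> I -> Prop) (p q : I -> Prop) :
    infinite_set [set: I] -> initial_order R ->
    (forall b, bounded_subset R b -> (forall j, b j -> q j) ->
       [set: I] #<= [set k | p k /\ forall j, b j -> F k j]) ->
    (forall a, bounded_subset R a -> (forall j, a j -> p j) ->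
       [set: I] #<= [set k | q k /\ forall j, a j -> F j k]) ->
  exists A B : set I, [/\ [set: I] #<= A, [set: I] #<= B &
    forall i j, A i -> B j -> F i j].
Proof.
move=> infI RI extA extB; have [[Rwf Rtr Rtot] _] := RI.
have [C [c [S [[Swf Str Stot] ccof Sbd]]]] := cofinal_order infI RI.
pose mono (w : I -> I) := forall j k, R j k -> R (w j) (w k).
(* For increasing [w] the block lies below [w (c i)], hence is bounded. *)
pose blk i (w : I -> I) := w @` segment R (c i).
pose before i (g : C -> I -> I) := [set a | exists2 j, S j i & blk j (g j) a].
pose good i (g : C -> (I -> I) * (I -> I)) := forall j, S j i ->
  [/\ mono (g j).1, mono (g j).2, forall k, p ((g j).1 k) & forall k, q ((g j).2 k)].
pose step i (A B : set I) (w : (I -> I) * (I -> I)) :=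
  [/\ mono w.1 /\ mono w.2, forall k, p (w.1 k) /\ q (w.2 k),
      forall k, ~ A (w.1 k) /\ ~ B (w.2 k),
      forall k, (forall b, B b -> F (w.1 k) b) /\ (forall a, A a -> F a (w.2 k)) &
      forall a l, blk i w.1 a -> F a (w.2 l)].
(* Nothing is asked after bad earlier choices, so a value always exists; [hgood] later removes this
   guard by induction. *)
pose P i g w := good i g ->
  step i (before i (fun j => (g j).1)) (before i (fun j => (g j).2)) w.
have two a b : exists k, R a k /\ R b k.
  have [k _ ak] := unbounded_of_card a infI RI (card_lexx _).
  have [l _ bl] := unbounded_of_card b infI RI (card_lexx _).
  case: (Rtot k l) => [kl|kl|lk]; [exists l|exists l|exists k]; split=> //.
  - exact: Rtr kl.
  - by rewrite -kl.
  - exact: Rtr lk.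
(* Block [j] lies below [g j (c j)], and [cofinal_order] bounds these values over all [j] before
   [i]. *)
have before_bd i g : (forall j, S j i -> mono (g j)) ->
    bounded_subset R (before i g).
  move=> gm; have [k kP] := Sbd i (fun j => g j (c j)).
  exists k => a [j ji [l lc <-]]; exact: Rtr (gm j ji _ _ lc) (kP _ ji).
have bd_setU a b : bounded_subset R a -> bounded_subset R b ->
    bounded_subset R (a `|` b).
  move=> [k ak] [l bl]; have [m [km lm]] := two k l.
  by exists m => u [/ak|/bl]; [move=> uk; exact: Rtr km|move=> ul; exact: Rtr lm].
have blk_bd i w : mono w -> bounded_subset R (blk i w).
  by move=> wm; exists (w (c i)) => _ [k kc <-]; exact: wm.
have [|i g|h hP] := @wf_choice C _ (id, id) S P Swf.
- move=> i g g' w gg' Pg good'.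
  have beforeE (k : (I -> I) * (I -> I) -> I -> I) :
      before i (fun j => k (g j)) = before i (fun j => k (g' j)).
    apply/seteqP; split=> a [j ji]; first by rewrite (gg' j ji) => ?; exists j.
    by rewrite -(gg' j ji) => ?; exists j.
  rewrite -(beforeE fst) -(beforeE snd); apply: Pg => j ji.
  by rewrite (gg' j ji); exact: good'.
- have [gd|ngd] := pselect (good i g); last by exists (id, id).
  pose A := before i (fun j => (g j).1); pose B := before i (fun j => (g j).2).
  have Abd : bounded_subset R A by apply: before_bd => j /gd[].
  have Bbd : bounded_subset R B by apply: before_bd => j /gd[].
  have Ap a : A a -> p a by move=> [j /gd[_ _ pj _] [k _ <-]]; exact: pj.
  have Bq b : B b -> q b by move=> [j /gd[_ _ _ qj] [k _ <-]]; exact: qj.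
  have [u uA] := Abd; have [v vB] := Bbd.
  (* The left points come first; the right ones are then chosen against the new left block as well,
     which settles pairs within one step. Removing the earlier points keeps blocks disjoint. *)
  have [w1 [w1P w1m]] := mono_enum RI (card_setD_bounded infI RI (extA _ Bbd Bq) uA).
  have A'bd := bd_setU _ _ Abd (blk_bd i _ w1m).
  have A'p a : (A `|` blk i w1) a -> p a.
    by move=> [/Ap//|[k _ <-]]; have [[]] := w1P k.
  have [w2 [w2P w2m]] := mono_enum RI (card_setD_bounded infI RI (extB _ A'bd A'p) vB).
  exists (w1, w2) => _; split=> [//|k|k|k|a l wa] /=.
  + by have [[? _] _] := w1P k; have [[? _] _] := w2P k.
  + by have [_ ?] := w1P k; have [_ ?] := w2P k.
  + have [[_ w1F] _] := w1P k; have [[_ w2F] _] := w2P k.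
    by split=> // a Aa; apply: w2F; left.
  + by have [[_ w2F] _] := w2P l; apply: w2F; right.
have hgood i : good i h.
  elim/(well_founded_ind Swf): i => i IHi j ji.
  have [[m1 m2] pq _ _ _] := hP j (IHi j ji).
  by split=> // k; have [] := pq k.
have hS i := hP i (hgood i).
have [d dE] := choice ccof.
(* The index [l] goes to position [l] of block [d l], where [l] is below [c (d l)]; disjointness of
   blocks makes this injective. *)
have big (k : (I -> I) * (I -> I) -> I -> I) :
    (forall i, mono (k (h i))) ->
    (forall i l, ~ before i (fun j => k (h j)) (k (h i) l)) ->
    [set: I] #<= [set a | exists i, blk i (k (h i)) a].
  move=> km kN; apply: (@card_le_of_inj _ _ _ _ (fun l => k (h (d l)) l)).
    by move=> l _; exists (d l), l => //; exact: dE.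
  move=> l l' _ _ ll'; case: (Stot (d l) (d l')) => [lt|dd|lt].
  - by case: (kN (d l') l'); exists (d l) => //; exists l => //; exact: dE.
  - rewrite dd in ll'; case: (Rtot l l') => // [|] /(km (d l')); rewrite ll'.
      by move=> /(wf_irrefl Rwf).
    by move=> /(wf_irrefl Rwf).
  - by case: (kN (d l) l); exists (d l') => //; exists l' => //; exact: dE.
exists [set a | exists i, blk i (h i).1 a], [set a | exists i, blk i (h i).2 a].
split.
- apply: (big fst) => [i|i l]; first by have [[]] := hS i.
  by have [_ _ /(_ l)[]] := hS i.
- apply: (big snd) => [i|i l]; first by have [[]] := hS i.
  by have [_ _ /(_ l)[]] := hS i.
- move=> a b [i ia] [j jb]; case: (Stot i j) => [ij|ij|ji].
  + case: jb => l _ <-; have [_ _ _ /(_ l)[_ hF] _] := hS j.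
    by apply: hF; exists i.
  + by subst j; case: jb => l _ <-; have [_ _ _ _ hF] := hS i; exact: hF.
  + case: ia => l _ <-; have [_ _ _ /(_ l)[hF _] _] := hS i.
    by apply: hF; exists j.
Qed.

Theorem polarized_partition (X Y I : Type) (f : X -> Y -> Prop) :
    infinite_set [set: I] ->
    (forall L : Type, ~ ([set: I] #<= [set: L]) -> [set: set L] #<= [set: I]) ->
    ~ ([set: X] #<= [set: I]) -> ~ ([set: Y] #<= [set: I]) ->
  exists (A : set X) (B : set Y) (e : bool),
    [/\ [set: I] #<= A, [set: I] #<= B &
        forall a b, A a -> B b -> (f a b <-> e)].
Proof.
move=> infI powI XI YI.
have [[A [B [IA IB nf]]]|nR] := pselect (exists (A : set X) (B : set Y),
    [/\ [set: I] #<= A, [set: I] #<= B & forall a b, A a -> B b -> ~ f a b]).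
  by exists A, B, false; split=> // a b Aa Bb; split=> // fab; case: (nf a b).
have fP (A : set X) (B : set Y) : [set: I] #<= A -> [set: I] #<= B ->
    exists a b, [/\ A a, B b & f a b].
  move=> IA IB; apply: contrapT => nf; apply: nR; exists A, B; split=> //.
  by move=> a b Aa Bb fab; apply: nf; exists a, b.
have [R RI] := initial_order_exists I.
have BI := bounded_subset_card infI RI powI.
have [x [y [xinj yinj xP yP]]] := reflecting_sequences f infI RI powI XI YI.
have [v vP] := generic_point y infI BI YI xinj fP.
have [|u uP] := @generic_point Y X I R (fun b a => f a b) y x infI BI XI yinj.
  by move=> B A IB IA; have [a [b [Aa Bb fab]]] := fP _ _ IA IB; exists b, a.
have [||A [B [IA IB ABF]]] := @rectangle_of_extensions I R
    (fun i j => f (x i) (y j)) (fun i => f (x i) v) (fun j => f u (y j)) infI RI.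
(* Since the points of [b] are joined to [u], their common neighbourhood is large; it reflects to
   [I] many terms of [x], of which [I] many are joined to [v]. *)
- move=> b bb bu; apply: (vP b bb).1; apply: (xP b bb); exact: (uP b bb).2.
- move=> b bb bv; apply: (uP b bb).1; apply: (yP b bb); exact: (vP b bb).2.
exists (x @` A), (y @` B), true; split.
- by apply: card_le_trans IA _; apply: (@card_le_of_inj _ _ _ _ x) => [i|i j _ _];
    [exists i|exact: xinj].
- by apply: card_le_trans IB _; apply: (@card_le_of_inj _ _ _ _ y) => [i|i j _ _];
    [exists i|exact: yinj].
- by move=> _ _ [i Ai <-] [j Bj <-]; split=> // _; exact: ABF.
Qed.

(** * Successor cardinals and the continuum hypothesis *)

Lemma card_le_succ (K : Type) : [set: K] #<= [set: card_succ K].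
Proof. by have [[]] := card_succP K. Qed.

Lemma card_succ_nle (K : Type) : ~ ([set: card_succ K] #<= [set: K]).
Proof. by have [[]] := card_succP K. Qed.

Lemma card_succ_le (K T : Type) (A : set T) :
  ~ (A #<= [set: K]) -> [set: card_succ K] #<= A.
Proof.
move=> AK; have [_ Kmin] := card_succP K.
rewrite -(card_le_eqr (card_setT A)); apply: Kmin.
rewrite /card_lt (card_le_eqr (card_setT A)) (card_le_eql (card_setT A)).
by split=> //; exact: card_leNge.
Qed.

Lemma infinite_card_le (T U : Type) (A : set T) (B : set U) :
  A #<= B -> infinite_set A -> infinite_set B.
Proof. by move=> AB infA /(card_le_finite AB). Qed.

Lemma card_succn_le (K : Type) i j : i <= j ->
  [set: card_succn K i] #<= [set: card_succn K j].
Proof.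
move=> /subnK<-; elim: (j - i) => [|k IHk]; first exact: card_lexx.
exact: card_le_trans IHk (card_le_succ _).
Qed.

Lemma card_le_powerset (T U : Type) :
  [set: T] #<= [set: U] -> [set: set T] #<= [set: set U].
Proof.
move=> /card_leT_inj[f finj].
apply: (@card_le_of_inj _ _ _ _ (fun A => f @` A)) => // A B _ _ AB.
apply/seteqP; split=> x Ax.
  by have [y By /finj <-] : (f @` B) (f x) by rewrite -AB; exists x.
by have [y By /finj <-] : (f @` A) (f x) by rewrite AB; exists x.
Qed.

(** For infinite [L] smaller than [K], the power set has size L^+, which is at most [K]; for finite
    [L] it is finite. *)
Lemma powerset_card_le (K L : Type) : infinite_set [set: K] ->
    (forall L : Type, infinite_set [set: L] -> [set: L] #<= [set: K] ->
       [set: set L] #= [set: card_succ L]) ->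
  ~ ([set: K] #<= [set: L]) -> [set: set L] #<= [set: K].
Proof.
move=> infK gch KL; have LK := card_leNge KL.
have [finL|infL] := pselect (finite_set [set: L]).
  apply: card_leNge => /card_le_finite Kfin.
  exact/infK/Kfin/finite_setT_set.
by rewrite (card_le_eql (gch L infL LK)); exact: card_succ_le.
Qed.

(** With k the size of [K]: (k^+)^k = (2^k)^k = 2^(k.k) = 2^k = k^+. *)
Lemma card_fun_le (K : Type) : infinite_set [set: K] ->
    [set: set K] #= [set: card_succ K] ->
  [set: K -> card_succ K] #<= [set: card_succ K].
Proof.
move=> infK powK; rewrite -(card_le_eqr powK).
apply: card_le_trans (card_le_powerset (card_le_prod infK)).
have [s sinj] : exists s : card_succ K -> set K, injective s.
  by apply: card_leT_inj; rewrite (card_le_eqr powK) card_lexx.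
apply: (@card_le_of_inj _ _ _ _ (fun u => [set x | s (u x.1) x.2])) => // u v _ _ uv.
apply/funext => k; apply: sinj; apply/funext => k'.
exact: (congr1 (fun A : set (K * K) => A (k, k')) uv).
Qed.

(** * From two parts to many *)

(** Inside a copy of K^+ in [A], the neighbours or the non-neighbours of a given [b] are more than
    [K]. Recording a colour and an injective enumeration of [K] many such points leaves K^+ possible
    records, so more than K^+ points of [B] share one. *)
Lemma homogeneous_refinement (K V : Type) (E : V -> V -> Prop) (A B : set V) :
    infinite_set [set: K] -> [set: set K] #= [set: card_succ K] ->
    ~ (A #<= [set: K]) -> ~ (B #<= [set: card_succ K]) ->
  exists (A' B' : set V) (e : bool),
    [/\ A' `<=` A, [set: K] #<= A', B' `<=` B, ~ (B' #<= [set: card_succ K]) &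
        forall a b, A' a -> B' b -> (E a b <-> e)].
Proof.
move=> infK powK AK BK; have infS := infinite_card_le (card_le_succ K) infK.
have [x0 Ax0] : A !=set0.
  by apply/set0P/eqP => A0; apply: AK; rewrite A0; exact: card_ge0.
have [h [hA hinj]] := card_le_inj_on x0 (card_succ_le AK).
have [s0 _] := infinite_setN0 infS.
have gP b : exists w : bool * (K -> card_succ K), injective w.2 /\
    forall k, E (h (w.2 k)) b <-> w.1.
  have side (D : set (card_succ K)) : ~ (D #<= [set: K]) ->
      exists w : K -> card_succ K, injective w /\ forall k, D (w k).
    move=> /card_leNge/(card_le_inj_on s0)[w [wD winj]].
    by exists w; split=> [k l|k]; [exact: winj|exact: wD].
  have [DK|/side[w [winj wD]]] := pselect ([set u | E (h u) b] #<= [set: K]).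
    have [|w [winj wD]] := side [set u | ~ E (h u) b].
      move=> NK; apply: (@card_succ_nle K).
      apply: card_le_trans (card_le_setU infK DK NK); apply: subset_card_le => u _.
      by have [?|?] := pselect (E (h u) b); [left|right].
    by exists (false, w); split=> // k; split=> // /(wD k).
  by exists (true, w); split=> // k; split=> // _; exact: wD.
have [g gE] := choice gP.
have [|[e w] Bew] := card_le_pigeonhole infS BK (f := g).
  apply: card_le_trans (card_leT _) _; rewrite -setXTT.
  apply: card_le_setX => //; last exact: card_fun_le.
  exact: card_le_trans (countableP _) (iffLR (infiniteP _) infS).
have [b0 [_ gb0]] : B `&` g @^-1` [set (e, w)] !=set0.
  by apply/set0P/eqP => B0; apply: Bew; rewrite B0; exact: card_ge0.
exists (range (fun k => h (w k))), (B `&` g @^-1` [set (e, w)]), e; split=> //.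
- by move=> _ [k _ <-]; exact: hA.
- apply: (@card_le_of_inj _ _ _ _ (fun k => h (w k))) => [k _|k l _ _ /hinj].
    by exists k.
  by move=> /(_ I I); have [+ _] := gE b0; rewrite gb0; exact.
- by move=> _ b [k _ <-] [_ gb]; have [_ /(_ k)] := gE b; rewrite gb.
Qed.

(** Bounding [L] by some finite successor of [K] makes the passage to [card_succ K] a mere shift of
    [j]. *)
Definition gch_upto_omega (K : Type) : Prop :=
  forall (j : nat) (L : Type), infinite_set [set: L] ->
    [set: L] #<= [set: card_succn K j] -> [set: set L] #= [set: card_succ L].

Lemma gch_upto_omega_succ (K : Type) :
  gch_upto_omega K -> gch_upto_omega (card_succ K).
Proof.
by move=> gch j L infL; rewrite /card_succn -iterSr => /(gch j.+1 L infL).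
Qed.

(** Induction on [n] with [K] varying: the earlier parts are treated for K^+, then cut down to [K]
    against the last part. That part must exceed K^+, which holds only from [n = 2] on; hence
    [n = 1] is a base case, given by [polarized_partition]. *)
Lemma pairwise_homogeneous (n : nat) (K V : Type) (E : V -> V -> Prop)
    (U : nat -> set V) :
    infinite_set [set: K] -> gch_upto_omega K ->
    (forall i, i <= n -> [set: card_succn K n] #<= U i) ->
  exists (A : nat -> set V) (e : nat -> nat -> bool),
    (forall i, i <= n -> A i `<=` U i /\ [set: K] #<= A i) /\
    (forall i j, i < j -> j <= n ->
       forall a b, A i a -> A j b -> (E a b <-> e i j)).
Proof.
elim: n K U => [|[|n] IHn] K U infK gch UK.
- exists U, (fun _ _ => true); split=> [i|i j ij]; first by move=> /UK; split.
  by rewrite leqn0 => /eqP j0; rewrite j0 in ij.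
- have UN i : i <= 1 -> ~ ([set: U i] #<= [set: K]).
    move=> i1; rewrite (card_le_eql (card_setT (U i))) => UiK.
    exact: (@card_succ_nle K (card_le_trans (UK i i1) UiK)).
  have powK L : ~ ([set: K] #<= [set: L]) -> [set: set L] #<= [set: K].
    exact: powerset_card_le infK (gch 0).
  have [A [B [e [KA KB AB]]]] := @polarized_partition (U 0) (U 1) K
    (fun a b => E (val a) (val b)) infK powK (UN 0 isT) (UN 1 isT).
  have valK (W : set V) (D : set W) : [set: K] #<= D -> [set: K] #<= val @` D.
    move=> /card_le_trans; apply.
    apply: (@card_le_of_inj _ _ _ _ val) => [u Du|u v _ _]; first by exists u.
    exact: val_inj.
  exists (fun i => if i is 0 then val @` A else val @` B), (fun _ _ => e).
  split=> [[_|[_|//]]|[|i] [|[|j]] // _ _ _ _ [a Aa <-] [b Bb <-]].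
  + by split; [move=> _ [u _ <-]; exact: set_valP|exact: valK].
  + by split; [move=> _ [u _ <-]; exact: set_valP|exact: valK].
  + exact: AB.
- have infS := infinite_card_le (card_le_succ K) infK.
  have SE k : card_succn (card_succ K) k = card_succn K k.+1.
    by rewrite /card_succn -iterSr.
  have [|A [e [AU Ae]]] := IHn (card_succ K) U infS (gch_upto_omega_succ gch).
    by move=> i i_n; rewrite SE; apply: UK; exact: ltnW.
  have powK := gch 0 K infK (card_lexx _).
  have AK i : i <= n.+1 -> ~ (A i #<= [set: K]).
    move=> /AU[_ KA] AiK; exact: (@card_succ_nle K (card_le_trans KA AiK)).
  (* Each [A i] is cut once, whereas [B] shrinks at every step and must stay larger than K^+. *)
  have refine_upto m : m <= n.+2 -> exists (A' : nat -> set V) (B : set V)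
      (e' : nat -> bool),
      [/\ B `<=` U n.+2, ~ (B #<= [set: card_succ K]) &
          forall i, i < m -> [/\ A' i `<=` A i, [set: K] #<= A' i &
            forall a b, A' i a -> B b -> (E a b <-> e' i)]].
    elim: m => [_|m IHm mn].
      exists A, (U n.+2), (fun=> true); split=> // UnK.
      apply: (@card_succ_nle (card_succn K n.+1)).
      apply: card_le_trans (UK n.+2 (leqnn _)) (card_le_trans UnK _).
      exact: (@card_succn_le K 1).
    have [A' [B [e' [BU BK A'B]]]] := IHm (ltnW mn).
    have [Am [Bm [em [AmA AmK BmB BmK Em]]]] :=
      homogeneous_refinement E infK powK (AK m mn) BK.
    exists (fun i => if i == m then Am else A' i), Bm,
      (fun i => if i == m then em else e' i); split=> [b /BmB/BU//|//|i].
    rewrite ltnS leq_eqVlt; have [-> _|_ /= /A'B[A'A A'K A'E]] := eqVneq i m.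
      by split.
    by split=> // a b A'a /BmB; exact: A'E.
  have [A' [B [e' [BU BK A'B]]]] := refine_upto _ (leqnn n.+2).
  exists (fun i => if i == n.+2 then B else A' i),
    (fun i j => if j == n.+2 then e' i else e i j); split=> [i|i j ij].
    rewrite leq_eqVlt; have [-> _|_ /= /[dup] i_n /A'B[A'A A'K _]] := eqVneq i n.+2.
      split=> //; apply: card_le_trans (card_le_succ K) _.
      exact: card_leNge.
    by split=> // a /A'A; exact: (AU i i_n).1.
  move=> jn a b; rewrite (ltn_eqF (leq_trans ij jn)).
  have [_|jNn] := eqVneq j n.+2; first by have [_ _] := A'B i (leq_trans ij jn); apply.
  have jn' : j < n.+2 by rewrite ltn_neqAle jNn.
  have [A'i _ _] := A'B i (leq_trans ij jn); have [A'j _ _] := A'B j jn'.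
  by move=> /A'i Aa /A'j Ab; exact: Ae.
Qed.

Theorem theorem3p3 (K : Type) (l : nat) (infK : infinite_set [set: K])
    (GCH : forall L : Type, infinite_set [set: L] ->
       card_lt L (card_succ_omega K) -> [set: set L] #= [set: card_succ L])
    (n m : nat) (hn : n = ramsey l) (hm : m = n - 1)
    (V : Type) (G : simple_graph V) (U : 'I_n -> set V)
    (GU : npartite G U)
    (cardU : forall i : 'I_n, U i #= [set: card_succn K m]) :
  exists (y : {set 'I_n}) (A : 'I_n -> set V),
    [/\ #|y| = l,
        forall i : 'I_n, i \in y -> A i `<=` U i /\ (A i #= [set: K]) &
        (forall i j : 'I_n, i \in y -> j \in y -> i <> j ->
           forall a b : V, A i a -> A j b -> adj G a b) \/
        (forall i j : 'I_n, i \in y -> j \in y -> i <> j ->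
           forall a b : V, A i a -> A j b -> ~ adj G a b)].
Proof.
have arrow : ramsey_arrow l n by rewrite hn /ramsey; case: ex_minnP.
have gch : gch_upto_omega K.
  (* Strictness holds because the supremum is also above the successor number [j.+1]. *)
  move=> j L infL Lj; apply: GCH => //; have [Kle _] := card_supP (card_succn K).
  split; first exact: card_le_trans Lj (Kle j).
  move=> KL; apply: (@card_succ_nle (card_succn K j)).
  exact: card_le_trans (Kle j.+1) (card_le_trans KL Lj).
pose U' i : set V := if insub i is Some i' then U i' else set0.
have U'E (i : 'I_n) : U' i = U i by rewrite /U' valK.
(* The case [n = 0] stands apart: subtraction truncates, so [n] is not [m.+1] there. *)
have [n0|[A [e [AU Ae]]]] : n = 0 \/ exists (A : nat -> set V) (e : nat -> nat -> bool),
    (forall i : 'I_n, A i `<=` U i /\ [set: K] #<= A i) /\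
    (forall i j : 'I_n, i < j -> forall a b, A i a -> A j b -> (adj G a b <-> e i j)).
- have [|n0] := boolP (n == 0); [by move/eqP; left|right].
  have nE : n = m.+1 by rewrite hm subn1 prednK// lt0n.
  have [i im|A [e [AU Ae]]] := @pairwise_homogeneous m K V (adj G) U' infK gch.
    have i_n : i < n by rewrite nE ltnS.
    by rewrite -[i]/(val (Ordinal i_n)) U'E (card_le_eqr (cardU _)) card_lexx.
  have ltm (i : 'I_n) : i <= m by rewrite -ltnS -nE.
  exists A, e; split=> [i|i j ij]; last exact: Ae.
  by rewrite -(U'E i); exact: AU.
- have no (i : 'I_n) : False by case: i => i; rewrite n0.
  have /forallP/(_ [ffun=> true])/existsP[H /andP[/eqP Hl _]] := arrow.
  by exists H, (fun=> set0); split=> //; left=> i; case: (no i).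
(* The sets found so far have size at least [K]; they are cut to size exactly [K]. *)
have CP (i : 'I_n) : exists C : set V, C `<=` A i /\ C #= [set: K].
  by have [_ /card_subP[C CK CA]] := AU i; exists C.
have [C CE] := choice CP.
(* Only the values of [e] at [i < j] are meaningful, so a pair is read in increasing order. *)
pose c : {ffun {set 'I_n} -> bool} := [ffun s : {set 'I_n} =>
  [exists i : 'I_n, [exists j : 'I_n, [&& i < j, s == [set i; j]%SET & e i j]]]].
have cE (i j : 'I_n) : i < j -> c [set i; j]%SET = e i j.
  move=> ij; rewrite ffunE; apply/existsP/idP => [[i' /existsP[j' /and3P[ij' /eqP sE]]]|eij].
    suff [-> ->] : i' = i /\ j' = j by [].
    have := finset.set21 i j; have := finset.set22 i j; rewrite sE !finset.inE.
    case/orP=> /eqP jE /orP[] /eqP iE; subst => //.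
    - by rewrite ltnn in ij.
    - by have := ltn_trans ij ij'; rewrite ltnn.
    - by rewrite ltnn in ij.
  by exists i; apply/existsP; exists j; rewrite ij eqxx.
have /forallP/(_ c)/existsP[H /andP[/eqP Hl /existsP[b /forallP Hb]]] := arrow.
have eb (i j : 'I_n) : i \in H -> j \in H -> i < j -> e i j = b.
  move=> iH jH ij; rewrite -cE//; apply/eqP/(implyP (Hb _)).
  rewrite cards2 finset.subUset !finset.sub1set iH jH /=.
  by have -> : i != j by apply: contraTneq ij => ->; rewrite ltnn.
have adjE (i j : 'I_n) : i \in H -> j \in H -> i <> j ->
    forall u v, C i u -> C j v -> (adj G u v <-> b).
  move=> iH jH ij u v Cu Cv.
  have Au := (CE i).1 _ Cu; have Av := (CE j).1 _ Cv.
  case: (ltngtP i j) => [lt|gt|/val_inj //].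
    by rewrite -(eb i j)//; exact: Ae.
  rewrite -(eb j i)//; have [vu uv] := Ae _ _ gt _ _ Av Au.
  by split=> [Guv|/uv Gvu]; [apply: vu|]; exact: adj_sym.
exists H, C; split=> // [i _|].
  by have [CA CK] := CE i; split=> // u /CA; exact: (AU i).1.
case: b {Hb eb} adjE => adjE; [left|right] => i j iH jH ij u v Cu Cv.
  exact/(adjE i j iH jH ij u v Cu Cv).
by move/(adjE i j iH jH ij u v Cu Cv).
Qed.
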